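(* Disjoint Paths can be solved in $O(2^n n^2 k)$ time, where $n$ is the number of vertices of the input graph and $k$ the number of terminal pairs.
   Context: Disjoint Paths: given a graph $G$ and pairwise disjoint terminal pairs $(s_1,t_1),\dots,(s_k,t_k)$ (all $2k$ vertices distinct), decide whether $G$ has pairwise vertex-disjoint paths $P^1,\dots,P^k$ with $P^i$ an $s_i$–$t_i$ path. *)

(* Defs.v *)
From mathcomp Require Import all_boot.
Set Implicit Arguments. Unset Strict Implicit. Unset Printing Implicit Defensive.

Definition simple_graph (n : nat) (e : rel 'I_n) : Prop :=
  symmetric e /\ irreflexive e.

Definition distinct_terminals (n k : nat) (s t : 'I_k -> 'I_n) : Prop :=
  injective s /\ injective t /\ forall i j, s i != t j.

Definition is_path (n : nat) (e : rel 'I_n) (x y : 'I_n) (p : seq 'I_n) : bool :=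
  [&& path e x p, last x p == y & uniq (x :: p)].

Definition disjoint_paths (n k : nat) (e : rel 'I_n) (s t : 'I_k -> 'I_n) : Prop :=
  exists P : 'I_k -> seq 'I_n,
    (forall i, is_path e (s i) (t i) (P i)) /\
    (forall i j, i != j -> [disjoint (s i :: P i) & (s j :: P j)]).

(* Memory is an infinite array of natural-number words; every instruction
   costs one time unit. Word size is bounded below (see [word_bounded]). *)

Definition mem := nat -> nat.
Definition upd (m : mem) (a v : nat) : mem := fun x => if x == a then v else m x.

Inductive binop := OAdd | OSub | OMul | ODiv | OMod | OAnd | OOr | OXor.

Definition eval_op (o : binop) (x y : nat) : nat :=
  match o with
  | OAdd => x + y | OSub => x - y | OMul => x * y
  | ODiv => x %/ y | OMod => x %% y
  | OAnd => Nat.land x y | OOr => Nat.lor x y | OXor => Nat.lxor x y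
  end.

Inductive instr :=
| IConst (d c : nat)            (* M[d] := c *)
| IOp (o : binop) (d a b : nat) (* M[d] := M[a] o M[b] *)
| ILoad (d a : nat)             (* M[d] := M[M[a]] *)
| IStore (a r : nat)            (* M[M[a]] := M[r] *)
| IJz (r l : nat)               (* if M[r] = 0 then goto l *)
| IHalt.

Definition state := (nat * mem)%type.  (* program counter, memory *)

(* One step; [None] means the machine has halted (Halt, or pc out of range). *)
Definition step (p : seq instr) (st : state) : option state :=
  let: (pc, m) := st in
  match nth IHalt p pc with
  | IConst d c => Some (pc.+1, upd m d c)
  | IOp o d a b => Some (pc.+1, upd m d (eval_op o (m a) (m b)))
  | ILoad d a => Some (pc.+1, upd m d (m (m a)))
  | IStore a r => Some (pc.+1, upd m (m a) (m r))
  | IJz r l => Some (if m r == 0 then l else pc.+1, m)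
  | IHalt => None
  end.

Fixpoint run (p : seq instr) (st : state) (T : nat) : option state :=
  match T with
  | 0 => Some st
  | T'.+1 => match run p st T' with Some s => step p s | None => None end
  end.

Definition halts_in (p : seq instr) (st : state) (T : nat) (st' : state) : Prop :=
  run p st T = Some st' /\ step p st' = None.

(* Word-size restriction: during the first T steps every memory word is at
   most B (word RAM with words of O(log B) bits). *)
Definition word_bounded (p : seq instr) (st : state) (T B : nat) : Prop :=
  forall i sti, i <= T -> run p st i = Some sti -> forall a, sti.2 a <= B.

(* M[0] = n, M[1] = k, M[2 + n*u + v] = [uv is an edge] for u, v < n,
   M[2 + n*n + 2i] = s_i, M[2 + n*n + 2i + 1] = t_i for i < k, else 0. *)
Definition adj_bit (n : nat) (e : rel 'I_n) (u v : nat) : nat :=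
  [exists u' : 'I_n, exists v' : 'I_n, [&& val u' == u, val v' == v & e u' v']].

Definition term_val (n k : nat) (f : 'I_k -> 'I_n) (i : nat) : nat :=
  match (insub i : option 'I_k) with Some i' => val (f i') | None => 0 end.

Definition input_size (n k : nat) : nat := 2 + n * n + 2 * k.

Definition encode (n k : nat) (e : rel 'I_n) (s t : 'I_k -> 'I_n) : mem :=
  fun x =>
    if x == 0 then n else if x == 1 then k
    else if x < 2 + n * n then adj_bit e ((x - 2) %/ n) ((x - 2) %% n)
    else if x < input_size n k then
      (let y := x - (2 + n * n) in
       if odd y then term_val t y./2 else term_val s y./2)
    else 0.

(* Main.v *)
From Stdlib Require Import FunctionalExtensionality.
Require Import Defs.
From mathcomp Require Import all_boot zify.
Set Implicit Arguments. Unset Strict Implicit. Unset Printing Implicit Defensive.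

(** Bellman-Held-Karp dynamic programming over triples [(i, S, v)]: paths
    [0, ..., i-1] are complete, path [i] currently ends at [v], and [S] is the
    bitmask of the vertices used so far.  A triple is extended either along an
    edge [v w] with [w] outside [S], or, when [v = t_i], by jumping to [s_(i+1)].
    Both moves strictly increase [S], so a single pass over all
    [(S, v, w, i)] in increasing order of [S] closes the table.  The pass is one
    loop whose counter [c < 2^n * n * n * k] is decoded by division, with a
    branch-free body; hence the running time is an explicit function of [n]
    and [k], and it dominates every address, so that words stay polynomial in
    the running time. *)

(** * Bitmasks and reachable states *)

(** A mask forgets which path owns which vertex. This is enough because simplicity and disjointness
    together say just that every appended vertex is new to the union. Terminals of later pairs get
    no protection: a path that runs over one of them sets its bit, and this blocks the later jump or
    arrival there.

    Since the loop body never branches, an illegal move is not skipped. It still computes an address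
    and writes there, but what it writes is an OR with 0, so a meaningless address does no harm.

    The delicate part is the word bound. One instruction can square a word, so a bound carried
    naively through the run would explode with the running time. The memory at every loop head is
    therefore known exactly, as a short register list over a heap of explicit form, and is bounded
    afresh there. Between two heads only a bounded number of squarings can occur, so the exponent
    depends on the length of the program and not on [n] or [k]. *)

Definition bit (m u : nat) : bool := odd (m %/ 2 ^ u).

(** Bit [w] is clear, so the addition carries nothing: inserting a vertex is a single [OAdd]. *)
Lemma bit_add_pow2 m w u :
  ~~ bit m w -> bit (m + 2 ^ w) u = (u == w) || bit m u.
Proof.
rewrite /bit => mw; case: (ltngtP u w) => [uw|wu|->] /=.
- rewrite -(subnK (ltnW uw)) expnD divnDMl ?expn_gt0 // oddD oddX.
  by rewrite subn_eq0 leqNgt uw addbF.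
- rewrite -(subnKC (ltnW wu)) expnD !divnMA -{1}(mul1n (2 ^ w)).
  rewrite divnDMl ?expn_gt0 //; move: (m %/ 2 ^ w) mw => a ev.
  have [d ->] : exists d, u - w = d.+1 by exists (u - w).-1; lia.
  rewrite expnS !divnMA; congr (odd (_ %/ _)); lia.
- by rewrite -{1}(mul1n (2 ^ w)) divnDMl ?expn_gt0 // addn1 /= mw.
Qed.

(** Divide by [2 ^ w]: the bound becomes even because [w < n], and the quotient of [m] is even
    because bit [w] is clear. An even number below an even bound stays below it after adding one. *)
Lemma bit_add_lt n m w : w < n -> m < 2 ^ n -> ~~ bit m w -> m + 2 ^ w < 2 ^ n.
Proof.
rewrite /bit => wn mn mw.
have w0 : 0 < 2 ^ w by rewrite expn_gt0.
have e2 : 2 ^ n = 2 * 2 ^ (n - w).-1 * 2 ^ w.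
  by rewrite -expnS -expnD prednK ?subn_gt0 ?subnK // ltnW.
have {}mn : m %/ 2 ^ w < 2 * 2 ^ (n - w).-1 by rewrite ltn_divLR // -e2.
rewrite e2 -ltn_divLR // -[X in m + X]mul1n divnDMl //.
by move: (m %/ 2 ^ w) (2 ^ (n - w).-1) mn mw => a b; lia.
Qed.

Lemma bit_pow2 w u : bit (2 ^ w) u = (u == w).
Proof.
have b0 v : bit 0 v = false by rewrite /bit div0n.
by rewrite -(add0n (2 ^ w)) bit_add_pow2 b0 // orbF.
Qed.

Section Reach.
Variables (n k : nat) (e : rel 'I_n) (s t : 'I_k -> 'I_n).

(* [reach i m v]: the dynamic programming state [(i, S, v)], with [m] the bitmask of [S]. *)
Inductive reach : nat -> nat -> 'I_n -> Prop :=
| reach_start (v : 'I_n) : 0 < k -> term_val s 0 = v -> reach 0 (2 ^ v) v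
| reach_edge i m (v w : 'I_n) :
    reach i m v -> e v w -> ~~ bit m w -> reach i (m + 2 ^ w) w
| reach_next i m (v w : 'I_n) :
    reach i m v -> i.+1 < k -> term_val t i = v -> term_val s i.+1 = w ->
    ~~ bit m w -> reach i.+1 (m + 2 ^ w) w.

Lemma term_valE (f : 'I_k -> 'I_n) (i : 'I_k) : term_val f i = f i.
Proof. by rewrite /term_val valK. Qed.

Lemma reach_bounds i m v : reach i m v -> i < k /\ m < 2 ^ n.
Proof.
elim=> {i m v} [v k0 _ | i m v w _ [ik mn] _ mw | i m v w _ [ik mn] ik1 _ _ mw].
- by rewrite ltn_exp2l.
- by split=> //; apply: bit_add_lt.
- by split=> //; apply: bit_add_lt.
Qed.

(** The last conjunct carries the induction: all paths so far lie inside the mask, so a vertex whose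
    bit is clear is on none of them and may extend the current path or start the next one. *)
Lemma reach_paths i m v : reach i m v ->
  exists P : 'I_k -> seq 'I_n,
  [/\ forall j : 'I_k, j < i -> is_path e (s j) (t j) (P j),
      forall j : 'I_k, val j = i -> is_path e (s j) v (P j),
      forall j j' : 'I_k, j <= i -> j' <= i -> j != j' ->
        [disjoint (s j :: P j) & (s j' :: P j')]
    & forall (j : 'I_k) u, j <= i -> u \in s j :: P j -> bit m u].
Proof.
elim=> {i m v}
  [v k0 sv | i m v w _ [P [Plt Peq Pdis Pbit]] vw mw
  | i m v w _ [P [Plt Peq Pdis Pbit]] ik tv sw mw].
- exists (fun=> [::]); split=> //.
  + move=> j j0; rewrite /is_path /= andbT; apply/eqP/val_inj.
    by rewrite /= -sv -j0 term_valE.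
  + move=> j j' j0 j'0 /eqP[]; apply: val_inj.
    by move: j0 j'0; rewrite !leqn0 => /eqP j0 /eqP j'0; rewrite /= j0 j'0.
  + move=> j u j0; rewrite inE => /eqP->; rewrite bit_pow2 -sv.
    have j00 : val j = 0 by move: j0 => /=; lia.
    by rewrite -j00 term_valE.
- have wP (j : 'I_k) : j <= i -> w \notin s j :: P j.
    by move=> ji; apply: contra mw; apply: Pbit.
  exists (fun j => if val j == i then rcons (P j) w else P j); split.
  + by move=> j ji; rewrite ltn_eqF //; apply: Plt.
  + move=> j ji; rewrite ji eqxx; have /and3P[pp /eqP pl pu] := Peq _ ji.
    apply/and3P; split.
    * by rewrite rcons_path pp pl.
    * by rewrite last_rcons.
    * by rewrite -rcons_cons rcons_uniq pu wP ?ji.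
  + move=> j j' ji j'i jj'.
    have mem_ext (a : 'I_k) u :
        u \in s a :: (if val a == i then rcons (P a) w else P a) ->
        (val a == i) && (u == w) \/ u \in s a :: P a.
      case: ifP => _; last by right.
      by rewrite -rcons_cons mem_rcons inE => /orP[->|]; [left|right].
    apply/pred0P => u; apply/negP => /= /andP[/mem_ext u1 /mem_ext u2].
    case: u1 u2 => [/andP[/eqP a1 /eqP ->]|u1] [/andP[/eqP a2 /eqP u2]|u2].
    * by case/eqP: jj'; apply: val_inj; rewrite /= a1 a2.
    * by move: (wP _ j'i); rewrite u2.
    * by move: (wP _ ji); rewrite -u2 u1.
    * by move: (Pdis _ _ ji j'i jj') => /pred0P/(_ u) /=; rewrite u1 u2.
  + move=> j u ji; rewrite bit_add_pow2 //; case: ifP => _.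
      rewrite -rcons_cons mem_rcons inE => /orP[/eqP->|]; first by rewrite eqxx.
      by move=> /Pbit -> //; rewrite orbT.
    by move=> /Pbit -> //; rewrite orbT.
- have sw' (j : 'I_k) : val j = i.+1 -> s j = w.
    by move=> ji; apply: val_inj; rewrite /= -sw -ji term_valE.
  have wP (j : 'I_k) : j <= i -> w \notin s j :: P j.
    by move=> ji; apply: contra mw; apply: Pbit.
  exists (fun j => if val j == i.+1 then [::] else P j); split.
  + move=> j; rewrite ltnS leq_eqVlt => /orP[/eqP ji|ji].
      have -> : (val j == i.+1) = false by rewrite /=; lia.
      have /and3P[pp /eqP pl pu] := Peq _ ji.
      apply/and3P; split=> //; rewrite pl; apply/eqP/val_inj.
      by rewrite /= -tv -ji term_valE.
    have -> : (val j == i.+1) = false by rewrite /=; lia.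
    exact: Plt.
  + by move=> j ji; rewrite ji eqxx /is_path /= sw' ?eqxx.
  + move=> j j' ji j'i jj'.
    have wdis (a b : 'I_k) : val a = i.+1 -> b <= i.+1 -> a != b ->
        [disjoint [:: s a] & s b :: (if val b == i.+1 then [::] else P b)].
      move=> ai bi ab; rewrite disjoint_cons disjoint0 // andbT sw' //.
      have bi' : val b != i.+1 by apply: contra ab => /eqP bi'; apply/eqP/val_inj; rewrite ai.
      by rewrite (negbTE bi') wP //; move: bi' bi => /=; lia.
    case: eqP => [ai|ai]; first exact: wdis.
    case: eqP => [bi|bi].
      rewrite disjoint_sym; have := wdis j' j bi ji.
      by move/eqP/negbTE: ai => ->; apply; rewrite eq_sym.
    by apply: Pdis => //; move: ai bi ji j'i => /=; lia.
  + move=> j u ji; rewrite bit_add_pow2 //; case: eqP => [ai|ai].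
      by rewrite inE sw' // => /eqP->; rewrite eqxx.
    by move/Pbit=> ->; [rewrite orbT | move: ai ji => /=; lia].
Qed.

Lemma reach_walk i m x p :
  reach i m x -> path e x p -> uniq p -> (forall u, u \in p -> ~~ bit m u) ->
  exists m', reach i m' (last x p) /\ forall u : 'I_n, bit m' u -> bit m u \/ u \in p.
Proof.
elim: p m x => [|y p IH] m x rx /=; first by move=> _ _ _; exists m; split=> //; left.
move=> /andP[xy py] /andP[yp up] mp.
have my : ~~ bit m y by apply: mp; rewrite inE eqxx.
case: (IH (m + 2 ^ y) y) => //.
- exact: reach_edge rx xy my.
- move=> u uinp; rewrite bit_add_pow2 // negb_or mp ?inE ?uinp ?orbT // andbT.
  by apply: contraNneq yp => /val_inj <-.
- move=> m' [rm' bm']; exists m'; split=> // u /bm'.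
  rewrite bit_add_pow2 // inE => -[/orP[/eqP/val_inj ->|]|->].
  + by right; rewrite eqxx.
  + by left.
  + by right; rewrite orbT.
Qed.

(** The mask inclusion is the reverse of the one in [reach_paths]: only vertices of paths already
    walked are marked, so the next path, being disjoint from them, meets clear bits only. *)
Lemma paths_reach (P : 'I_k -> seq 'I_n) :
  (forall i, is_path e (s i) (t i) (P i)) ->
  (forall i j, i != j -> [disjoint (s i :: P i) & (s j :: P j)]) ->
  forall i : 'I_k, exists m, reach i m (t i) /\
    forall u : 'I_n, bit m u -> exists2 j : 'I_k, j <= i & u \in s j :: P j.
Proof.
move=> Pp Pd [i ik]; elim: i ik => [|i IH] ik.
- have /and3P[pp /eqP pl] := Pp (Ordinal ik); rewrite cons_uniq => /andP[sp pu].
  have r0 : reach 0 (2 ^ s (Ordinal ik)) (s (Ordinal ik)).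
    by apply: reach_start => //; rewrite -[0]/(val (Ordinal ik)) term_valE.
  case: (reach_walk r0 pp pu) => [u uP|m [rm bm]].
    by rewrite bit_pow2; apply: contra sp => /eqP/val_inj <-.
  exists m; rewrite -pl; split=> // u /bm; rewrite bit_pow2 => ub.
  exists (Ordinal ik) => //; rewrite inE.
  by case: ub => [/eqP/val_inj ->|->]; rewrite ?eqxx ?orbT.
- have ik' := ltnW ik; have [m0 [r0 b0]] := IH ik'.
  have /and3P[pp /eqP pl] := Pp (Ordinal ik); rewrite cons_uniq => /andP[sp pu].
  have fresh u : u \in s (Ordinal ik) :: P (Ordinal ik) -> ~~ bit m0 u.
    move=> uP; apply/negP => /b0[j ji uj].
    have /pred0P/(_ u) /= : [disjoint s j :: P j & s (Ordinal ik) :: P (Ordinal ik)].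
      by apply: Pd; apply/eqP => /(congr1 val) /=; move: ji => /=; lia.
    by rewrite uj uP.
  have ms := fresh _ (mem_head _ _).
  have r1 : reach i.+1 (m0 + 2 ^ s (Ordinal ik)) (s (Ordinal ik)).
    apply: (reach_next r0) => //.
    + by rewrite -[X in term_val _ X]/(val (Ordinal ik')) term_valE.
    + by rewrite -[X in term_val _ X]/(val (Ordinal ik)) term_valE.
  case: (reach_walk r1 pp pu) => [u uP|m [rm bm]].
    rewrite bit_add_pow2 // negb_or fresh ?inE ?uP ?orbT // andbT.
    by apply: contra sp => /eqP/val_inj <-.
  exists m; rewrite -pl; split=> // u /bm; rewrite bit_add_pow2 // => -[/orP[]|uP].
  + by move=> /eqP/val_inj->; exists (Ordinal ik) => //; rewrite mem_head.
  + by case/b0 => j ji uj; exists j => //; apply: leqW.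
  + by exists (Ordinal ik) => //; rewrite inE uP orbT.
Qed.

Lemma disjoint_pathsE : 0 < k ->
  disjoint_paths e s t <->
  exists m (v : 'I_n), reach k.-1 m v /\ term_val t k.-1 = v.
Proof.
move=> k0; have kk : k.-1 < k by rewrite prednK.
split=> [[P [Pp Pd]]|[m [v [rv tv]]]].
- have [m [rm _]] := paths_reach Pp Pd (Ordinal kk).
  exists m, (t (Ordinal kk)); split=> //.
  by rewrite -[X in term_val _ X]/(val (Ordinal kk)) term_valE.
- have [P [Plt Peq Pdis _]] := reach_paths rv.
  have jk (j : 'I_k) : j <= k.-1 by rewrite -ltnS prednK.
  exists P; split=> [i|i j]; last exact: Pdis.
  have := jk i; rewrite leq_eqVlt => /orP[/eqP ik|]; last exact: Plt.
  have -> : t i = v by apply: val_inj; rewrite /= -tv -ik term_valE.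
  exact: Peq.
Qed.

End Reach.

(** * Word-RAM executions *)

Lemma run_add p st a b :
  run p st (a + b) = if run p st a is Some st' then run p st' b else None.
Proof.
elim: b => [|b IH]; first by rewrite addn0; case: run.
by rewrite addnS /= IH; case: run.
Qed.

Definition words_le (B : nat) (m : Defs.mem) : Prop := forall a, m a <= B.

Definition runs p B st T st' : Prop :=
  run p st T = Some st' /\
  forall i sti, i <= T -> run p st i = Some sti -> words_le B sti.2.

Lemma runs_trans p B st T st' T' st'' :
  runs p B st T st' -> runs p B st' T' st'' -> runs p B st (T + T') st''.
Proof.
move=> [r1 w1] [r2 w2]; split; first by rewrite run_add r1.
move=> i sti iT ri; case: (leqP i T) => [iT1|Ti]; first exact: w1 ri.
move: ri; rewrite -(subnKC (ltnW Ti)) run_add r1; apply: w2; lia.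
Qed.

(** The first hypothesis is the word bound on the initial memory, which is all that remains to show
    when [N = 0]. *)
Lemma runs_iter p B h L (st : nat -> Defs.mem) N :
  runs p B (h, st 0) 0 (h, st 0) ->
  (forall c, c < N -> runs p B (h, st c) L (h, st c.+1)) ->
  runs p B (h, st 0) (N * L) (h, st N).
Proof.
move=> st0; elim: N => [|N IH] H; first by rewrite mul0n.
rewrite mulSnr; apply: runs_trans (H N _) => //.
by apply: IH => c cN; apply: H; apply: ltnW.
Qed.

Definition const_le B (i : instr) : bool := if i is IConst _ c then c <= B else true.

(** Here [u] is the fuel, one bit per unit. A result bit is set only where some argument bit is, so
    it is paid for by the bits of [x] and [y] at that position. *)
Lemma bitwise_le f x y u : f false false = false ->
  Nat.bitwise f u x y <= x + y.
Proof.
move=> f0; elim: u x y => [|u IH] x y //=.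
have xE : x = Nat.div2 x + Nat.div2 x + nat_of_bool (Nat.odd x).
  by have := PeanoNat.Nat.div2_odd x; case: (Nat.odd _) => /=; rewrite !plusE ?addn0 => {1}->.
have yE : y = Nat.div2 y + Nat.div2 y + nat_of_bool (Nat.odd y).
  by have := PeanoNat.Nat.div2_odd y; case: (Nat.odd _) => /=; rewrite !plusE ?addn0 => {1}->.
have := IH (Nat.div2 x) (Nat.div2 y).
move: xE yE; set c := Nat.bitwise _ _ _ _.
case: (Nat.odd x); case: (Nat.odd y); rewrite ?f0;
  try match goal with |- context [f ?d ?g] => case: (f d g) end;
  move: c (Nat.div2 x) (Nat.div2 y) => c a b /=; rewrite -?plusE; lia.
Qed.

Lemma eval_op_le B o x y : 1 < B -> x <= B -> y <= B -> eval_op o x y <= B ^ 2.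
Proof.
move=> B1 xB yB.
have add : x + y <= B ^ 2 by rewrite expnS expn1; nia.
have xle : x <= B ^ 2 by lia.
case: o => //=.
- lia.
- by rewrite expnS expn1 leq_mul.
- by apply: leq_trans xle; apply: leq_div.
- by apply: leq_trans xle; apply: leq_mod.
- by apply: leq_trans add; apply: bitwise_le.
- by apply: leq_trans add; apply: bitwise_le.
- by apply: leq_trans add; apply: bitwise_le.
Qed.

Lemma step_words p B st st' : 1 < B -> all (const_le B) p ->
  words_le B st.2 -> step p st = Some st' -> words_le (B ^ 2) st'.2.
Proof.
case: st => pc m B1 pB /= mB.
have up a : m a <= B ^ 2.
  by apply: leq_trans (mB a) _; rewrite -{1}(expn1 B) leq_exp2l.
have updw a v : v <= B ^ 2 -> words_le (B ^ 2) (upd m a v).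
  by move=> vB x; rewrite /upd; case: ifP.
case pcE: nth => [d c|o d a b|d a|a r|r l|] // [<-] //=; apply: updw => //.
- case: (ltnP pc (size p)) => pcs; last by move: pcE; rewrite nth_default.
  have := all_nthP IHalt pB _ pcs; rewrite pcE /= => cB.
  by apply: leq_trans cB _; rewrite -{1}(expn1 B) leq_exp2l.
- exact: eval_op_le.
Qed.

(* One instruction at most squares the largest word, so a block of bounded length
   stays polynomial; loops reset the bound at each head. *)
Lemma run_words p B st j st' : 1 < B -> all (const_le B) p ->
  words_le B st.2 -> run p st j = Some st' -> words_le (B ^ (2 ^ j)) st'.2.
Proof.
move=> B1 pB stB; elim: j st' => [|j IH] st' /=; first by case=> <-.
case rj: run => [st1|] // s1; rewrite expnSr expnM.
have B1j : B <= B ^ (2 ^ j) by rewrite -{1}(expn1 B) leq_exp2l // expn_gt0.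
apply: (@step_words p (B ^ (2 ^ j)) st1) => //.
- exact: leq_trans B1j.
- by apply: sub_all pB => -[] //= _ c cB; apply: leq_trans B1j.
- exact: IH.
Qed.

Lemma runs_of_run p B L st T st' : 1 < B -> all (const_le B) p -> T <= L ->
  words_le B st.2 -> run p st T = Some st' -> runs p (B ^ (2 ^ L)) st T st'.
Proof.
move=> B1 pB TL stB rT; split=> // i sti iT ri a.
apply: leq_trans (run_words B1 pB stB ri a) _.
by rewrite leq_exp2l // leq_exp2l // (leq_trans iT).
Qed.

(** The low cells of [H] are shadowed by the registers, so [H] may keep stale values there, such as
    the original input. *)
Definition reg_mem (rs : seq nat) (H : Defs.mem) : Defs.mem :=
  fun a => if a < size rs then nth 0 rs a else H a.

Lemma reg_mem_words B rs H : all (leq^~ B) rs ->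
  (forall a, size rs <= a -> H a <= B) -> words_le B (reg_mem rs H).
Proof.
by move=> rsB HB a; rewrite /reg_mem; case: ltnP => [/(all_nthP 0 rsB)//|]; apply: HB.
Qed.

Lemma upd_reg_mem_reg rs H d v : d < size rs ->
  upd (reg_mem rs H) d v = reg_mem (set_nth 0 rs d v) H.
Proof.
move=> ds; apply: functional_extensionality => x.
rewrite /upd /reg_mem size_set_nth nth_set_nth /=.
have -> : maxn d.+1 (size rs) = size rs by apply/maxn_idPr.
by case: eqP => // ->; rewrite ds.
Qed.

Lemma upd_reg_mem_heap rs H a v : size rs <= a ->
  upd (reg_mem rs H) a v = reg_mem rs (upd H a v).
Proof.
move=> sa; apply: functional_extensionality => x; rewrite /upd /reg_mem.
by case: eqP => // ->; rewrite ltnNge sa.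
Qed.

Definition wf_instr R (i : instr) : bool :=
  match i with
  | IConst d _ => d < R
  | IOp _ d a b => [&& d < R, a < R & b < R]
  | ILoad d a => (d < R) && (a < R)
  | IStore a r => (a < R) && (r < R)
  | _ => false
  end.

(* Symbolic execution of straight-line code; it agrees with the machine as long as
   every indirect address avoids the register file, see [safe]. *)
Fixpoint sym (b : seq instr) (rs : seq nat) (H : Defs.mem) : seq nat * Defs.mem :=
  match b with
  | [::] => (rs, H)
  | i :: b' =>
    match i with
    | IConst d c => sym b' (set_nth 0 rs d c) H
    | IOp o d x y => sym b' (set_nth 0 rs d (eval_op o (nth 0 rs x) (nth 0 rs y))) H
    | ILoad d x => sym b' (set_nth 0 rs d (H (nth 0 rs x))) H
    | IStore x r => sym b' rs (upd H (nth 0 rs x) (nth 0 rs r))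
    | _ => sym b' rs H
    end
  end.

Fixpoint safe (R : nat) (b : seq instr) (rs : seq nat) (H : Defs.mem) : Prop :=
  match b with
  | [::] => True
  | i :: b' =>
    match i with
    | IConst d c => safe R b' (set_nth 0 rs d c) H
    | IOp o d x y => safe R b' (set_nth 0 rs d (eval_op o (nth 0 rs x) (nth 0 rs y))) H
    | ILoad d x => R <= nth 0 rs x /\ safe R b' (set_nth 0 rs d (H (nth 0 rs x))) H
    | IStore x r => R <= nth 0 rs x /\ safe R b' rs (upd H (nth 0 rs x) (nth 0 rs r))
    | _ => safe R b' rs H
    end
  end.

Lemma run_block p pc b R rs H :
  take (size b) (drop pc p) = b -> all (wf_instr R) b -> size rs = R ->
  safe R b rs H ->
  run p (pc, reg_mem rs H) (size b) = Some (pc + size b, reg_mem (sym b rs H).1 (sym b rs H).2).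
Proof.
elim: b pc rs H => [|i b IH] pc rs H; first by rewrite addn0.
move=> dp /andP[wi wb] srs sf; rewrite -[size (i :: b)]/(1 + size b) run_add.
have pcp : pc < size p by rewrite ltnNge; apply/negP => pcp; rewrite drop_oversize in dp.
move: dp; rewrite (drop_nth IHalt pcp) /= => -[ni db].
have sset d v : d < R -> size (set_nth 0 rs d v) = R.
  by move=> dR; rewrite size_set_nth srs; apply/maxn_idPr.
have rd x : x < R -> reg_mem rs H x = nth 0 rs x by move=> xR; rewrite /reg_mem srs xR.
have hp x : R <= x -> reg_mem rs H x = H x by move=> xR; rewrite /reg_mem srs ltnNge xR.
rewrite ni -addSnnS; move: {ni} i wi sf => [d c|o d x y|d x|x r|//|//] /=.
- by move=> dR sf; rewrite upd_reg_mem_reg ?srs // IH // sset.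
- by move=> /and3P[dR xR yR] sf; rewrite upd_reg_mem_reg ?srs // !rd // IH // sset.
- by move=> /andP[dR xR] [sx sf]; rewrite upd_reg_mem_reg ?srs // (rd x xR) hp // IH // sset.
- by move=> /andP[xR rR] [sx sf]; rewrite !rd // upd_reg_mem_heap ?srs // IH.
Qed.

Lemma run_jz p pc r l m : nth IHalt p pc = IJz r l -> m r = 0 ->
  run p (pc, m) 1 = Some (l, m).
Proof. by move=> /= -> ->. Qed.

Lemma run_jnz p pc r l m : nth IHalt p pc = IJz r l -> m r != 0 ->
  run p (pc, m) 1 = Some (pc.+1, m).
Proof. by move=> /= -> /negbTE ->. Qed.

(** * The program *)

Definition clear (r l : nat) : seq instr := [seq IConst j 0 | j <- iota r l].

(* Fixed registers 0..22 lie inside the encoded input, so the input is first moved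
   to [X + j], where [X = (n^2 + 2k + n)^2 - 3].  Cells 3..22 are saved one by one:
   the first save needs only register 2 as an address (hence the [- 3]), since cell
   2 holds the loop bit of vertex 0, which is 0 and need not be saved. *)
Definition setup_code : seq instr :=
  [:: IOp OMul 2 0 0; IOp OAdd 2 2 1; IOp OAdd 2 2 1; IOp OAdd 2 2 0; IOp OMul 2 2 2;
      IStore 2 3; IConst 3 3; IOp OSub 2 2 3]
  ++ flatten [seq [:: IConst 3 j; IOp OAdd 3 2 3; IStore 3 j] | j <- iota 4 19]
  ++ [:: IConst 3 1; IConst 4 0; IConst 6 2; IOp OAdd 6 2 6; IOp OMul 5 0 0;
         IOp OAdd 5 5 6; IOp OAdd 7 2 2; IOp OAdd 8 7 2;
         IOp OAdd 9 5 1; IOp OAdd 9 9 1; IOp OSub 9 9 2; IConst 10 23]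
  ++ clear 11 12.

Definition copy_code : seq instr :=
  [:: ILoad 13 10; IOp OAdd 12 2 10; IStore 12 13; IOp OAdd 10 10 3] ++ clear 12 2.

Definition pow_init_code : seq instr := [:: IConst 9 1; IConst 10 0].

(** There is no shift or power instruction, so powers of two are tabulated by doubling. Register 9
    ends at [2 ^ n], from which [main_init_code] builds the iteration count. *)
Definition pow_code : seq instr :=
  [:: IOp OAdd 12 7 10; IStore 12 9; IOp OAdd 9 9 9; IOp OAdd 10 10 3; IConst 12 0].

Definition main_init_code : seq instr :=
  [:: IOp OMul 9 9 0; IOp OMul 9 9 0; IOp OMul 9 9 1;
      ILoad 12 5; IOp OAdd 13 7 12; ILoad 13 13;
      IOp OMul 13 13 0; IOp OAdd 13 13 12; IOp OMul 13 13 1; IOp OAdd 13 13 8;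
      IStore 13 3; IConst 10 0] ++ clear 12 2.

(* Registers: 0 = n, 1 = k, 2 = X, 3 = 1, 4 = 0, 5 and 6 = bases of the terminal
   and adjacency arrays, 7 = 2X (table of powers of 2), 8 = 3X (table of flags),
   9 = number of iterations, 10 = counter, 11 = answer; 12..22 are scratch and are
   0 at every loop head.  Equality tests are computed as [1 - (|x - y| + ...)] with
   truncated subtraction. *)
Definition main_code : seq instr :=
  [:: IOp OMod 12 10 1; IOp ODiv 13 10 1; IOp ODiv 15 13 0; IOp OMod 13 13 0;
      IOp OMod 14 15 0;
      IOp OMul 16 15 1; IOp OAdd 16 16 12; IOp OAdd 16 16 8; ILoad 16 16;
      IOp ODiv 15 15 0;
      IOp OAdd 17 7 13; ILoad 17 17; IConst 20 2;
      IOp ODiv 18 15 17; IOp OMod 18 18 20; IOp OSub 18 3 18; IOp OMul 18 18 16;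
      IOp OAdd 15 15 17; IOp OMul 15 15 0; IOp OAdd 15 15 13; IOp OMul 15 15 1;
      IOp OAdd 15 15 12; IOp OAdd 15 15 8;
      IOp OMul 19 14 0; IOp OAdd 19 19 13; IOp OAdd 19 19 6; ILoad 19 19;
      IOp OMul 19 19 18;
      IOp OAdd 21 12 12; IOp OAdd 21 21 5; IOp OAdd 21 21 3; ILoad 20 21;
      IOp OAdd 21 21 3; ILoad 21 21;
      IOp OSub 22 14 20; IOp OSub 20 20 14; IOp OAdd 14 22 20;
      IOp OSub 22 13 21; IOp OSub 21 21 13; IOp OAdd 13 22 21;
      IOp OAdd 12 12 3; IOp OSub 12 1 12;
      IOp OAdd 22 14 12; IOp OSub 22 3 22; IOp OMul 22 22 16; IOp OOr 11 11 22;
      IOp OSub 12 3 12; IOp OAdd 14 14 13; IOp OAdd 14 14 12; IOp OSub 14 3 14;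
      IOp OMul 14 14 18;
      ILoad 20 15; IOp OOr 20 20 19; IStore 15 20;
      IOp OAdd 15 15 3; ILoad 20 15; IOp OOr 20 20 14; IStore 15 20;
      IOp OAdd 10 10 3] ++ clear 12 11.

(** By truncated subtraction the loop continues while register [y] is below register [x]. Register 4
    holds 0, so [IJz 4 h] jumps unconditionally. *)
Definition loop_code (x y h : nat) (b : seq instr) : seq instr :=
  [:: IOp OSub 12 x y; IJz 12 (h + 3 + size b)] ++ b ++ [:: IJz 4 h].

Definition copy_pc := 1 + size setup_code.
Definition pow_init_pc := copy_pc + 3 + size copy_code.
Definition pow_pc := pow_init_pc + size pow_init_code.
Definition main_init_pc := pow_pc + 3 + size pow_code.
Definition main_pc := main_init_pc + size main_init_code.
Definition end_pc := main_pc + 3 + size main_code.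

(** With [k = 0] the answer is always yes, and [n] may be too small for the memory layout, so this
    case leaves at once for the final [IConst 0 1]. *)
Definition dp_prog : seq instr :=
  [:: IJz 1 (end_pc + 2)] ++ setup_code ++ loop_code 9 10 copy_pc copy_code
  ++ pow_init_code ++ loop_code 0 10 pow_pc pow_code
  ++ main_init_code ++ loop_code 9 10 main_pc main_code
  ++ [:: IOp OAdd 0 11 4; IHalt; IConst 0 1; IHalt].

(** * Execution of a single loop *)

Section Loop.
Variables (p : seq instr) (h x y : nat) (b : seq instr) (rs : seq nat) (H : Defs.mem).
Hypothesis pE : take (size b + 3) (drop h p) = loop_code x y h b.
Hypotheses (srs : size rs = 23) (xR : x < 23) (yR : y < 23).
Let d := nth 0 rs x - nth 0 rs y.
Let rs1 := set_nth 0 rs 12 d.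

Lemma loop_nth j : j < size b + 3 -> nth IHalt p (h + j) = nth IHalt (loop_code x y h b) j.
Proof. by move=> jb; rewrite -pE nth_take // nth_drop. Qed.

Lemma run_loop_test : run p (h, reg_mem rs H) 1 = Some (h + 1, reg_mem rs1 H).
Proof.
have l0 : nth IHalt p h = IOp OSub 12 x y by rewrite -{1}(addn0 h) loop_nth // addn3.
rewrite /= l0 addn1 upd_reg_mem_reg ?srs //.
by rewrite /reg_mem srs xR yR.
Qed.

Lemma run_loop_exit : d = 0 -> run p (h, reg_mem rs H) 2 = Some (h + 3 + size b, reg_mem rs1 H).
Proof.
move=> d0; rewrite -[2]/(1 + 1) run_add run_loop_test.
apply: (@run_jz _ _ 12); first by rewrite loop_nth // addn3.
by rewrite /reg_mem size_set_nth srs /= nth_set_nth /= d0.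
Qed.

Lemma run_loop_body : d != 0 -> all (wf_instr 23) b -> safe 23 b rs1 H ->
  size (sym b rs1 H).1 = 23 -> nth 0 (sym b rs1 H).1 4 = 0 ->
  run p (h, reg_mem rs H) (size b + 3) = Some (h, reg_mem (sym b rs1 H).1 (sym b rs1 H).2).
Proof.
move=> d0 wb sb s4 r4; rewrite addn3 -[_.+3]/(1 + (1 + (size b).+1)) run_add run_loop_test.
have s1 : size rs1 = 23 by rewrite size_set_nth srs.
rewrite run_add (@run_jnz _ _ 12 (h + 3 + size b)) //; first last.
- by rewrite /reg_mem s1 /= nth_set_nth.
- by rewrite loop_nth // addn3.
rewrite -[(size b).+1]addn1 run_add (@run_block p _ b 23) //; last first.
  have : drop 2 (take (size b + 3) (drop h p)) = b ++ [:: IJz 4 h].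
    by rewrite pE /= drop0.
  rewrite -[3]/(1 + 2) addnA addn1 -take_drop drop_drop => pb.
  have := congr1 (take (size b)) pb; rewrite take_size_cat // take_takel //.
  by rewrite addn1 add2n.
apply: (@run_jz _ _ 4).
  have -> : (h + 1).+1 + size b = h + (size b).+2 by lia.
  rewrite loop_nth; last by lia.
  by rewrite /= nth_cat ltnn subnn.
by rewrite /reg_mem s4.
Qed.

End Loop.

(** The sums are bracketed as symbolic execution produces them, so that the execution lemmas close
    by [reflexivity]. *)
Definition regs n k X a b c : seq nat :=
  [:: n; k; X; 1; 0; n * n + (X + 2); X + 2; X + X; X + X + X; a; b; c;
      0; 0; 0; 0; 0; 0; 0; 0; 0; 0; 0].

Definition copyH (m : Defs.mem) X b : Defs.mem :=
  fun a => if (X + 3 <= a) && (a < X + b) then m (a - X) else m a.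

Definition powH (H : Defs.mem) Y b : Defs.mem :=
  fun a => if (Y <= a) && (a < Y + b) then 2 ^ (a - Y) else H a.

Lemma copyH_upd m X b : 3 <= b -> upd (copyH m X b) (X + b) (m b) = copyH m X b.+1.
Proof.
move=> b3; apply: functional_extensionality => a; rewrite /upd /copyH.
case: eqP => [->|ab]; first by rewrite addKn leq_add2l b3 ltn_add2l ltnSn.
by congr (if _ then _ else _); lia.
Qed.

Lemma powH_upd H Y b : upd (powH H Y b) (Y + b) (2 ^ b) = powH H Y b.+1.
Proof.
apply: functional_extensionality => a; rewrite /upd /powH.
case: eqP => [->|ab]; first by rewrite addKn leq_addr ltn_add2l ltnSn.
by congr (if _ then _ else _); lia.
Qed.

Lemma copyH3 m X : copyH m X 3 = m.
Proof.
by apply: functional_extensionality => a; rewrite /copyH ltnNge andbN.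
Qed.

Lemma powH0 H Y : powH H Y 0 = H.
Proof.
by apply: functional_extensionality => a; rewrite /powH addn0 ltnNge andbN.
Qed.

Lemma dp_prog_setup : take (size setup_code) (drop 1 dp_prog) = setup_code.
Proof. by []. Qed.

Lemma dp_prog_copy : take (size copy_code + 3) (drop copy_pc dp_prog)
  = loop_code 9 10 copy_pc copy_code.
Proof. by []. Qed.

Lemma dp_prog_pow : take (size pow_code + 3) (drop pow_pc dp_prog)
  = loop_code 0 10 pow_pc pow_code.
Proof. by []. Qed.

Lemma dp_prog_main : take (size main_code + 3) (drop main_pc dp_prog)
  = loop_code 9 10 main_pc main_code.
Proof. by []. Qed.

(** The square lifts the base above the 23 registers and above twice the input length, while its
    computation writes to register 2 alone. *)
Definition copy_base n k := (n * n + k + k + n) * (n * n + k + k + n) - 3.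

Ltac symbolic t :=
  let v := eval cbv -[addn muln subn divn modn expn Nat.lor upd leq copyH powH] in t in
  change t with v.
Ltac symbolic_sym := match goal with |- context [sym ?b ?rs ?H] => symbolic (sym b rs H) end.
Ltac symbolic_safe := match goal with |- safe ?R ?b ?rs ?H => symbolic (safe R b rs H) end.

(** * Effect of each segment of the program *)

Lemma run_setup (m : Defs.mem) n k : m 0 = n -> m 1 = k ->
  let X := copy_base n k in 23 <= X ->
  run dp_prog (1, m) (size setup_code)
    = Some (copy_pc, reg_mem (regs n k X (n * n + 2 + k + k) 23 0) (copyH m X 23)).
Proof.
move=> m0 m1 X X23.
have mE : m = reg_mem [seq m j | j <- iota 0 23] m.
  apply: functional_extensionality => a; rewrite /reg_mem size_map size_iota.
  by case: ltnP => // a23; rewrite (nth_map 0) ?size_iota // nth_iota.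
(* The truncated subtraction in [copy_base] is exact because [X] is positive. *)
have QX : (n * n + k + k + n) * (n * n + k + k + n) = X + 3.
  by rewrite subnK //; move: X23; rewrite /X /copy_base; lia.
have sf : safe 23 setup_code [seq m j | j <- iota 0 23] m.
  by symbolic_safe; rewrite m0 m1 QX !addnK; do !split; lia.
have srs : size [seq m j | j <- iota 0 23] = 23 by [].
have wf : all (wf_instr 23) setup_code by [].
rewrite [in LHS]mE (run_block dp_prog_setup wf srs sf).
symbolic_sym; rewrite m0 m1 QX !addnK /=.
have -> : upd m (X + 3) (m 3) = copyH m X 4 by rewrite -copyH_upd // copyH3.
rewrite !copyH_upd //.
have -> : n * n + (X + 2) + k + k - X = n * n + 2 + k + k by lia.
reflexivity.
Qed.

Lemma run_copy n k X z j m : 23 <= j -> j < z -> 23 <= X ->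
  (forall a, j <= a < z -> copyH m X j a = m a) ->
  run dp_prog (copy_pc, reg_mem (regs n k X z j 0) (copyH m X j)) (size copy_code + 3)
    = Some (copy_pc, reg_mem (regs n k X z j.+1 0) (copyH m X j.+1)).
Proof.
move=> j23 jz X23 mj.
have mjj : copyH m X j j = m j by rewrite mj // leqnn.
have d0 : z - j != 0 by rewrite subn_eq0 -ltnNge.
have sf : safe 23 copy_code (set_nth 0 (regs n k X z j 0) 12 (z - j)) (copyH m X j).
  by symbolic_safe; do !split; lia.
rewrite (@run_loop_body dp_prog copy_pc 9 10 copy_code (regs n k X z j 0) (copyH m X j)
  dp_prog_copy erefl isT isT d0 isT sf erefl erefl).
symbolic_sym; rewrite /= mjj copyH_upd ?addn1; last by lia.
reflexivity.
Qed.

Lemma run_pow n k X j H : j < n -> 23 <= X ->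
  run dp_prog (pow_pc, reg_mem (regs n k X (2 ^ j) j 0) (powH H (X + X) j)) (size pow_code + 3)
    = Some (pow_pc, reg_mem (regs n k X (2 ^ j.+1) j.+1 0) (powH H (X + X) j.+1)).
Proof.
move=> jn X23.
have d0 : n - j != 0 by rewrite subn_eq0 -ltnNge.
have sf : safe 23 pow_code (set_nth 0 (regs n k X (2 ^ j) j 0) 12 (n - j))
    (powH H (X + X) j).
  by symbolic_safe; do !split; lia.
rewrite (@run_loop_body dp_prog pow_pc 0 10 pow_code (regs n k X (2 ^ j) j 0)
  (powH H (X + X) j) dp_prog_pow erefl isT isT d0 isT sf erefl erefl).
symbolic_sym; rewrite /= powH_upd addn1 (addnn (2 ^ j)) -mul2n -expnS.
reflexivity.
Qed.

(** Follows [main_code] term by term. If [w] is in [S] then [q = 0] and both stores change nothing.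
    If [i + 1 = k], then [tgt + 1] is the cell of index 0 in the next slot, and [r = 0] makes the
    value ORed into it 0. *)
Definition main_step n k X c (a : nat) (H : Defs.mem) : nat * Defs.mem :=
  let W := X + X + X in
  let i := c %% k in
  let w := c %/ k %% n in
  let c2 := c %/ k %/ n in
  let v := c2 %% n in
  let S := c2 %/ n in
  let E := H (c2 * k + i + W) in
  let pw := H (X + X + w) in
  let q := (1 - S %/ pw %% 2) * E in
  let tgt := ((S + pw) * n + w) * k + i + W in
  let f := H (v * n + w + (X + 2)) * q in
  let z := i + i + (n * n + (X + 2)) + 1 in
  let dv := v - H z + (H z - v) in
  let dw := w - H (z + 1) + (H (z + 1) - w) in
  let r := k - (i + 1) in
  let H1 := upd H tgt (Nat.lor (H tgt) f) in
  (Nat.lor a ((1 - (dv + r)) * E),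
   upd H1 (tgt + 1) (Nat.lor (H1 (tgt + 1)) ((1 - (dv + dw + (1 - r))) * q))).

Lemma run_main n k X N c a H : c < N -> 23 <= X ->
  run dp_prog (main_pc, reg_mem (regs n k X N c a) H) (size main_code + 3)
    = Some (main_pc, reg_mem (regs n k X N c.+1 (main_step n k X c a H).1)
                        (main_step n k X c a H).2).
Proof.
move=> cN X23.
have d0 : N - c != 0 by rewrite subn_eq0 -ltnNge.
have sf : safe 23 main_code (set_nth 0 (regs n k X N c a) 12 (N - c)) H.
  have XW y : 23 <= y + (X + X + X) by lia.
  have XW1 y : 23 <= y + (X + X + X) + 1 by lia.
  have XP y : 23 <= X + X + y by lia.
  have XA y : 23 <= y + (X + 2) by lia.
  have XT y : 23 <= y + (n * n + (X + 2)) + 1 by lia.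
  have XS y : 23 <= y + (n * n + (X + 2)) + 1 + 1 by lia.
  symbolic_safe; (do !split);
    first [exact: XW | exact: XW1 | exact: XP | exact: XA | exact: XT | exact: XS].
rewrite (@run_loop_body dp_prog main_pc 9 10 main_code (regs n k X N c a) H
  dp_prog_main erefl isT isT d0 isT sf erefl erefl).
symbolic_sym; rewrite -(addn1 c).
reflexivity.
Qed.

Lemma run_copy_exit n k X z j H : z <= j ->
  run dp_prog (copy_pc, reg_mem (regs n k X z j 0) H) 2
    = Some (pow_init_pc, reg_mem (regs n k X z j 0) H).
Proof.
rewrite -subn_eq0 => /eqP zj.
rewrite (@run_loop_exit dp_prog copy_pc 9 10 copy_code (regs n k X z j 0) H
  dp_prog_copy erefl isT isT zj) [nth _ _ _ - nth _ _ _]zj.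
reflexivity.
Qed.

Lemma run_pow_exit n k X a H :
  run dp_prog (pow_pc, reg_mem (regs n k X a n 0) H) 2
    = Some (main_init_pc, reg_mem (regs n k X a n 0) H).
Proof.
rewrite (@run_loop_exit dp_prog pow_pc 0 10 pow_code (regs n k X a n 0) H
  dp_prog_pow erefl isT isT (subnn n)) [nth _ _ _ - nth _ _ _]subnn.
reflexivity.
Qed.

Lemma run_main_exit n k X N a H :
  run dp_prog (main_pc, reg_mem (regs n k X N N a) H) 2
    = Some (end_pc, reg_mem (regs n k X N N a) H).
Proof.
rewrite (@run_loop_exit dp_prog main_pc 9 10 main_code (regs n k X N N a) H
  dp_prog_main erefl isT isT (subnn N)) [nth _ _ _ - nth _ _ _]subnn.
reflexivity.
Qed.

Lemma run_pow_init n k X z j H :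
  run dp_prog (pow_init_pc, reg_mem (regs n k X z j 0) H) 2
    = Some (pow_pc, reg_mem (regs n k X 1 0 0) H).
Proof.
have dp : take (size pow_init_code) (drop pow_init_pc dp_prog) = pow_init_code by [].
have wf : all (wf_instr 23) pow_init_code by [].
have srs : size (regs n k X z j 0) = 23 by [].
have sf : safe 23 pow_init_code (regs n k X z j 0) H by [].
by rewrite (run_block dp wf srs sf); symbolic_sym.
Qed.

Lemma run_main_init n k X j p H : 23 <= X ->
  let s0 := H (n * n + (X + 2)) in
  run dp_prog (main_init_pc, reg_mem (regs n k X p j 0) H) (size main_init_code)
    = Some (main_pc, reg_mem (regs n k X (p * n * n * k) 0 0)
              (upd H ((H (X + X + s0) * n + s0) * k + (X + X + X)) 1)).
Proof.
move=> X23 s0.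
have dp : take (size main_init_code) (drop main_init_pc dp_prog) = main_init_code by [].
have wf : all (wf_instr 23) main_init_code by [].
have srs : size (regs n k X p j 0) = 23 by [].
have sf : safe 23 main_init_code (regs n k X p j 0) H.
  by symbolic_safe; do !split; lia.
rewrite (run_block dp wf srs sf); symbolic_sym.
reflexivity.
Qed.

Lemma run_end n k X a b c H :
  run dp_prog (end_pc, reg_mem (regs n k X a b c) H) 1
    = Some (end_pc.+1, upd (reg_mem (regs n k X a b c) H) 0 c).
Proof.
transitivity (Some (end_pc.+1, upd (reg_mem (regs n k X a b c) H) 0 (c + 0))).
  reflexivity.
by rewrite addn0.
Qed.

(** * Correctness of the table *)

Lemma mulnD_inj k q q' i i' : i < k -> i' < k -> q * k + i = q' * k + i' ->
  q = q' /\ i = i'.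
Proof.
move=> ik i'k E; have k0 : 0 < k by lia.
have := congr1 (divn^~ k) E; have := congr1 (modn^~ k) E.
by rewrite !modnMDl !modn_small // !divnMDl // !divn_small // !addn0.
Qed.

Lemma lor_le1 a b : a <= 1 -> b <= 1 ->
  Nat.lor a b <= 1 /\ (Nat.lor a b != 0) = (a != 0) || (b != 0).
Proof. by case: a b => [|[|a]] [|[|b]]. Qed.

Section Invariant.
Variables (n k : nat) (e : rel 'I_n) (s t : 'I_k -> 'I_n) (X : nat).
Hypotheses (k0 : 0 < k) (n0 : 0 < n).
Hypothesis Xbig : n * n + k + k + 4 <= X.
Let W := X + X + X.

(** With [i] as the lowest digit, the next pair is the neighbouring cell, so both moves share one
    address computation. *)
Definition cell i S v := (S * n + v) * k + i + W.
(* The iteration at which the loop processes [(S, v, w, i)]. *)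
Definition tick i S v w := ((S * n + v) * n + w) * k + i.

Definition input_ok (H : Defs.mem) : Prop :=
  [/\ forall v w : 'I_n, H (v * n + w + (X + 2)) = e v w,
      forall i, i < k -> H (i + i + (n * n + (X + 2)) + 1) = term_val t i,
      forall i, i.+1 < k -> H (i + i + (n * n + (X + 2)) + 1 + 1) = term_val s i.+1
    & forall w, w < n -> H (X + X + w) = 2 ^ w].

Lemma input_ok_eq G H : (forall x, x < W -> H x = G x) -> input_ok G -> input_ok H.
Proof.
rewrite /W => HG [Ge Gt Gs Gp].
split=> [v w|i ik|i ik|w wn]; rewrite HG ?Ge ?Gt ?Gs ?Gp //; try by lia.
- have vn : v * n + n <= n * n by rewrite addnC -mulSn leq_mul2r ltn_ord orbT.
  have := ltn_ord w; lia.
- have : n <= n * n by rewrite leq_pmull.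
  lia.
Qed.

Lemma cell_inj i S (v : 'I_n) i' S' (v' : 'I_n) : i < k -> i' < k ->
  cell i S v = cell i' S' v' -> [/\ i = i', S = S' & v = v'].
Proof.
move=> ik i'k /addIn /(mulnD_inj ik i'k) [+ ->].
by move=> /(mulnD_inj (ltn_ord v) (ltn_ord v')) [-> /val_inj ->].
Qed.

Lemma cellS i S v : (cell i S v).+1 = cell i.+1 S v.
Proof. by rewrite /cell -addSn -addnS. Qed.

Lemma tick_inj i S (v w : 'I_n) i' S' (v' w' : 'I_n) : i < k -> i' < k ->
  tick i S v w = tick i' S' v' w' -> [/\ i = i', S = S', v = v' & w = w'].
Proof.
move=> ik i'k /(mulnD_inj ik i'k) [+ ->].
move=> /(mulnD_inj (ltn_ord w) (ltn_ord w')) [+ /val_inj ->].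
by move=> /(mulnD_inj (ltn_ord v) (ltn_ord v')) [-> /val_inj ->].
Qed.

Lemma tick_lt i S (v w : 'I_n) i' S' (v' w' : 'I_n) : i < k ->
  S < S' -> tick i S v w < tick i' S' v' w'.
Proof.
move=> ik SS'.
have h1 : S * n + v < S' * n.
  apply: leq_trans (_ : S.+1 * n <= _); last by rewrite leq_mul2r SS' orbT.
  by rewrite mulSnr ltn_add2l.
have h2 : (S * n + v) * n + w < (S' * n) * n.
  apply: leq_trans (_ : (S * n + v).+1 * n <= _); last by rewrite leq_mul2r h1 orbT.
  by rewrite mulSnr ltn_add2l.
have h3 : tick i S v w < (S' * n * n) * k.
  apply: leq_trans (_ : ((S * n + v) * n + w).+1 * k <= _); last by rewrite leq_mul2r h2 orbT.
  by rewrite mulSnr ltn_add2l.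
apply: leq_trans h3 _; rewrite /tick !mulnDl -!addnA; exact: leq_addr.
Qed.

Lemma tick_decode c : exists i S (v w : 'I_n), i < k /\ c = tick i S v w.
Proof.
have vn a : a %% n < n by rewrite ltn_mod.
exists (c %% k), (c %/ k %/ n %/ n), (Ordinal (vn (c %/ k %/ n))), (Ordinal (vn (c %/ k))).
by rewrite ltn_mod k0 /tick /= -!divn_eq.
Qed.

Lemma main_stepP a H i S (v w : 'I_n) : i < k -> input_ok H ->
  (forall x, W <= x -> H x <= 1) -> a <= 1 ->
  let st := main_step n k X (tick i S v w) a H in
  let fl := H (cell i S v) != 0 in
  let tgt := cell i (S + 2 ^ w) w in
  [/\ st.1 <= 1,
      (st.1 != 0) = (a != 0) || [&& fl, i.+1 == k & term_val t i == v],
      forall x, x < W -> st.2 x = H x,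
      forall x, W <= x -> st.2 x <= 1
    & forall x, W <= x -> (st.2 x != 0) =
        [|| H x != 0, [&& fl, ~~ bit S w, e v w & x == tgt]
          | [&& fl, ~~ bit S w, i.+1 < k, term_val t i == v, term_val s i.+1 == w
              & x == tgt.+1]]].
Proof.
move=> ik [He Ht Hs Hp] H1 a1.
rewrite /main_step /= /tick !modnMDl !divnMDl // !(modn_small ik) !(divn_small ik) !addn0.
rewrite !modnMDl !divnMDl // !(modn_small (ltn_ord _)) !(divn_small (ltn_ord _)) !addn0.
rewrite !modnMDl !divnMDl // !(modn_small (ltn_ord _)) !(divn_small (ltn_ord _)) !addn0.
rewrite Hp // He Ht // -/W -!/(cell _ _ _) modn2 -/(bit S w) !addn1.
set E := H (cell i S v); set tgt := cell i (S + 2 ^ w) w.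
have E1 : E <= 1 by apply: H1; apply: leq_addl.
have E01 : E = 0 \/ E = 1 by lia.
have tW : W <= tgt by apply: leq_addl.
set b := 1 - bit S w.
set dv := v - _ + _.
set g := (1 - (dv + _ + (1 - _))) * (b * E).
have bE : b = ~~ bit S w by rewrite /b; case: (bit S w).
have dv0 : (dv == 0) = (term_val t i == v) by rewrite /dv; lia.
clearbody dv.
have g1 : g <= 1.
  by rewrite /g bE; case: (bit S w); case: E01 => ->; rewrite ?muln0 // ?muln1 leq_subr.
have gE : (g != 0) = [&& E != 0, ~~ bit S w, i.+1 < k, term_val t i == v & term_val s i.+1 == w].
  rewrite /g bE -dv0; case: (ltnP i.+1 k) => ik1; last first.
    (* For the last pair the cell read as [s (i+1)] lies past the terminals and has no known value;
       the truncated factor vanishes whatever it holds. *)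
    have -> : k - i.+1 = 0 by lia.
    by rewrite subn0 addn1 subSS sub0n mul0n !andbF.
  have -> : 1 - (k - i.+1) = 0 by lia.
  have := Hs _ ik1; rewrite !addn1 => ->.
  rewrite !muln_eq0 !negb_or; case: (bit S w); rewrite ?andbF //=.
  case: E01 => -> /=; rewrite ?andbF //=; lia.
set f := (e v w) * (b * E).
have f1 : f <= 1.
  by rewrite /f bE; case: (bit S w); case: (e v w); case: E01 => ->.
have fE : (f != 0) = [&& E != 0, ~~ bit S w & e v w].
  by rewrite /f bE; case: (bit S w); case: (e v w); case: E01 => ->.
have [lf1 lfE] := lor_le1 (H1 _ tW) f1.
have utgt : upd H tgt (Nat.lor (H tgt) f) tgt.+1 = H tgt.+1 by rewrite /upd gtn_eqF.
rewrite utgt.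
have [lg1 lgE] := lor_le1 (H1 _ (leqW tW)) g1.
set h := (1 - (dv + _)) * E.
have h1 : h <= 1 by rewrite /h; case: E01 => ->; rewrite ?muln0 // muln1 leq_subr.
have hE : (h != 0) = [&& E != 0, i.+1 == k & term_val t i == v].
  rewrite /h -dv0 muln_eq0 negb_or subn_eq0 -ltnNge ltnS leqn0 addn_eq0 subn_eq0.
  by rewrite (eqn_leq i.+1 k) ik /= andbC [(dv == 0) && _]andbC.
have [lh1 lhE] := lor_le1 a1 h1.
split=> //.
- by rewrite lhE hE.
- move=> x xW; have xt := leq_trans xW tW.
  by rewrite /upd !ltn_eqF // leqW.
- by move=> x xW; rewrite /upd; do 2 (case: eqP => [?|_] //); apply: H1.
- move=> x xW; rewrite /upd; case: (x =P tgt.+1) => [->|_].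
    rewrite lgE gE !andbT; have -> : (tgt.+1 == tgt) = false by rewrite gtn_eqF.
    by rewrite !andbF.
  case: (x =P tgt) => [->|_]; last by rewrite !andbF !orbF.
  by rewrite lfE fE !andbT !andbF orbF.
Qed.

(** Soundness of the flags holds throughout, but completeness cannot: midway it is expressed as
    closure under the moves already tried. Once all ticks have passed, induction on [reach] turns
    closure into completeness. *)
Record dp_inv (G : Defs.mem) (c a : nat) (H : Defs.mem) : Prop := DpInv {
  inv_input : forall x, x < W -> H x = G x;
  inv_flag : forall x, W <= x -> H x <= 1;
  inv_ans : a <= 1;
  inv_start : forall v : 'I_n, term_val s 0 = v -> H (cell 0 (2 ^ v) v) != 0;
  inv_sound : forall i S (v : 'I_n), i < k -> H (cell i S v) != 0 -> reach e s t i S v;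
  inv_ans_sound : a != 0 ->
    exists m (v : 'I_n), reach e s t k.-1 m v /\ term_val t k.-1 = v;
  inv_closed : forall i S (v w : 'I_n), i < k -> tick i S v w < c ->
    H (cell i S v) != 0 ->
    [/\ e v w -> ~~ bit S w -> H (cell i (S + 2 ^ w) w) != 0,
        i.+1 < k -> term_val t i = v -> term_val s i.+1 = w -> ~~ bit S w ->
        H (cell i.+1 (S + 2 ^ w) w) != 0
      & i.+1 = k -> term_val t i = v -> a != 0] }.

(* A flag set at time [c] has a strictly larger mask than the one processed at [c],
   so no transition out of it has been processed yet. *)
Lemma inv_step G c a H : input_ok G -> dp_inv G c a H ->
  dp_inv G c.+1 (main_step n k X c a H).1 (main_step n k X c a H).2.
Proof.
move=> iG [iH fH aH stH sH asH cH].
have [i [S [v [w [ik cE]]]]] := tick_decode c.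
have iok := input_ok_eq iH iG.
have [a1 aE Hlt Hle HE] := main_stepP S v w ik iok fH aH.
rewrite cE; set st := main_step _ _ _ _ _ _ in a1 aE Hlt Hle HE *.
have cellW j S' v' : W <= cell j S' v' by apply: leq_addl.
have mono j S' v' : H (cell j S' v') != 0 -> st.2 (cell j S' v') != 0.
  by move=> h; rewrite HE // h.
have new j S' (v' : 'I_n) : j < k -> st.2 (cell j S' v') != 0 ->
    H (cell j S' v') != 0 \/
    [/\ H (cell i S v) != 0, ~~ bit S w, S' = S + 2 ^ w, v' = w &
      (j = i /\ e v w) \/
      [/\ j = i.+1, term_val t i = v & term_val s i.+1 = w]].
  move=> jk; rewrite HE // => /or3P[->|/and4P[fl b ed /eqP E]|].
  - by left.
  - by have [-> -> ->] := cell_inj jk ik E; right; split=> //; left.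
  - move=> /and3P[fl b /and4P[ik1 /eqP tv /eqP sw /eqP]].
    rewrite cellS => E; have [-> -> ->] := cell_inj jk ik1 E.
    by right; split=> //; right.
have lt2 : S < S + 2 ^ w by rewrite -addn1 leq_add2l expn_gt0.
split=> //.
- by move=> x xW; rewrite Hlt // iH.
- by move=> v' /stH /mono.
- move=> j S' v' jk /(new _ _ _ jk) [/sH|[/(sH _ _ _ ik) r b -> ->]]; first exact.
  case=> [[-> ed]|[jE tv sw]]; first exact: reach_edge r ed b.
  by move: jk; rewrite jE => ik1; apply: reach_next r ik1 tv sw b.
- rewrite aE => /orP[/asH //|/and3P[fl /eqP ik1 /eqP tv]].
  have iE : k.-1 = i by rewrite -ik1.
  by exists S, v; rewrite iE; split=> //; apply: sH.
- move=> j S' v' w' jk; rewrite ltnS leq_eqVlt => /orP[/eqP tE|lt]; last first.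
    move=> /(new _ _ _ jk) [fl|[_ _ SE _ _]]; last first.
      have := tick_lt v w j v' w' ik lt2; move: lt; rewrite SE; lia.
    have [c1 c2 c3] := cH _ _ _ _ jk (eq_ind_r (fun z => _ < z) lt cE) fl.
    split=> [ed b|jk1 tv sw b|jk1 tv].
    + by apply: mono; apply: c1.
    + by apply: mono; apply: c2.
    + by rewrite aE c3.
  have [-> -> -> ->] := tick_inj jk ik tE.
  move=> /(new _ _ _ ik) [fl|[_ _ SE _ _]]; last by lia.
  split=> [ed b|ik1 tv sw b|ik1 tv].
  + by rewrite HE // fl b ed eqxx orbT.
  + by rewrite HE // fl b ik1 tv sw cellS !eqxx !orbT.
  + by rewrite aE fl ik1 tv !eqxx orbT.
Qed.

Lemma inv_final G a H : dp_inv G (2 ^ n * n * n * k) a H ->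
  a != 0 <-> disjoint_paths e s t.
Proof.
move=> [_ _ _ stH _ asH cH]; rewrite disjoint_pathsE //; split=> [/asH //|].
case=> m [v [r tv]].
have tickN i S (v' w' : 'I_n) : i < k -> S < 2 ^ n -> tick i S v' w' < 2 ^ n * n * n * k.
  (* The iteration count is the tick of mask [2 ^ n] with all lower digits 0. *)
  move=> ik Sn; have := tick_lt v' w' 0 (Ordinal n0) (Ordinal n0) ik Sn.
  by rewrite /tick /= !addn0.
have flag i S v' : reach e s t i S v' -> H (cell i S v') != 0.
  elim=> {i S v'} [v' _ /stH //|i S v' w r' IH ed b|i S v' w r' IH ik1 tv' sw b].
  - have [ik Sn] := reach_bounds r'.
    by have [+ _ _] := cH _ _ _ w ik (tickN _ _ v' w ik Sn) IH; apply.
  - have [ik Sn] := reach_bounds r'.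
    by have [_ + _] := cH _ _ _ w ik (tickN _ _ v' w ik Sn) IH; apply.
have [ik mn] := reach_bounds r.
(* The answer is recorded at every [w], so any vertex serves; [v] is at hand. *)
have [_ _] := cH _ _ _ v ik (tickN _ _ v v ik mn) (flag _ _ _ r).
by apply=> //; rewrite prednK.
Qed.

End Invariant.

(** * Running time and word size *)

Section Encoding.
Variables (n k : nat) (e : rel 'I_n) (s t : 'I_k -> 'I_n).
Let m := encode e s t.

Lemma adj_bitE (v w : 'I_n) : adj_bit e v w = e v w.
Proof.
rewrite /adj_bit; congr nat_of_bool; apply/existsP/idP.
  by case=> v' /existsP[w' /and3P[/eqP/val_inj-> /eqP/val_inj->]].
by move=> vw; exists v; apply/existsP; exists w; rewrite !eqxx.
Qed.

Lemma term_val_le (f : 'I_k -> 'I_n) i : term_val f i <= n.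
Proof. by rewrite /term_val; case: insub => [j|] //; apply: ltnW (ltn_ord _). Qed.

Lemma encode_le a : m a <= input_size n k.
Proof.
have h1 : n <= n * n by case: n => // p; rewrite leq_pmull.
have le1 (b : bool) : b <= input_size n k by case: b.
rewrite /m /encode; case: ifP => _; first by rewrite /input_size; lia.
case: ifP => _; first by rewrite /input_size; lia.
case: ifP => _; first exact: le1.
case: ifP => // _ /=.
by case: ifP => _; apply: leq_trans (term_val_le _ _) _; rewrite /input_size; lia.
Qed.

Lemma encode_out a : input_size n k <= a -> m a = 0.
Proof.
move=> za; rewrite /m /encode ltnNge ?[a < input_size _ _]ltnNge za /=.
move: za; rewrite /input_size => za.
do 2 (case: eqP => [?|_]; first by lia).
by case: leqP => //; lia.
Qed.

Lemma encode_adj (v w : 'I_n) : m (v * n + w + 2) = e v w.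
Proof.
have n0 : 0 < n by case: n v => // -[].
have vn : v * n + n <= n * n by rewrite addnC -mulSn leq_mul2r ltn_ord orbT.
have wn := ltn_ord w.
rewrite /m /encode; do 2 (case: eqP => [?|_]; first by lia).
rewrite (_ : _ + 2 < 2 + n * n); last by lia.
by rewrite addnK divnMDl // modnMDl divn_small // modn_small // addn0 adj_bitE.
Qed.

Lemma encode_term y : y < 2 * k ->
  m (y + (n * n + 2)) = if odd y then term_val t y./2 else term_val s y./2.
Proof.
move=> yk; rewrite /m /encode /input_size; do 2 (case: eqP => [?|_]; first by lia).
rewrite (_ : _ < 2 + n * n = false); last by lia.
rewrite (_ : y + _ < _); last by lia.
by rewrite (_ : y + _ - _ = y); last by lia.
Qed.

End Encoding.

Lemma regs_words B n k X a b c H : n <= B -> k <= B -> X + X + X + n * n + 2 <= B ->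
  a <= B -> b <= B -> c <= B -> (forall x, H x <= B) ->
  words_le B (reg_mem (regs n k X a b c) H).
Proof.
move=> nB kB XB aB bB cB HB; apply: reg_mem_words => //.
rewrite /regs /= nB kB aB bB cB !andbT; do !(apply/andP; split=> //); lia.
Qed.

(** The first pair already has two distinct ends. This matters for the layout: at [n = k = 1] the
    value of [copy_base] is 13, inside the registers. *)
Lemma terminals_card n k (s t : 'I_k -> 'I_n) :
  distinct_terminals s t -> 0 < k -> 1 < n.
Proof.
move=> [_ [_ st]] k0; have := st (Ordinal k0) (Ordinal k0); rewrite -val_eqE /=.
have := ltn_ord (s (Ordinal k0)); have := ltn_ord (t (Ordinal k0)); lia.
Qed.

Section Sizes.
Variables (n k : nat).
Hypotheses (n2 : 1 < n) (k0 : 0 < k).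
Let n0 : 0 < n := ltnW n2.
Let X := copy_base n k.
Let z := n * n + 2 + k + k.
Let N := 2 ^ n * n * n * k.

Lemma copy_base_ge : 61 <= X /\ z + z <= X.
Proof.
have nn : 2 * 2 <= n * n by apply: leq_mul.
have Q8 : 8 * (n * n + k + k + n) <= (n * n + k + k + n) * (n * n + k + k + n).
  by rewrite leq_mul2r; apply/orP; right; lia.
rewrite /X /copy_base /z; lia.
Qed.

Lemma copy_base_gt_input : n * n + k + k + 4 <= X.
Proof. by have [X61 zX] := copy_base_ge; move: zX; rewrite /z; lia. Qed.

Definition dp_time : nat :=
  1 + size setup_code + (z - 23) * (size copy_code + 3) + 2 + 2
  + n * (size pow_code + 3) + 2 + size main_init_code
  + N * (size main_code + 3) + 2 + 1.

(** Copying costs at most [27 * N], the powers [8 * N], the main loop [73 * N], and everything else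
    113 steps; 200 is a round figure above these. The lower bound lets the running time dominate the
    counter and the powers of two. *)
Lemma dp_time_bounds :
  [/\ N = 2 ^ n * n ^ 2 * k, N + 23 <= dp_time & dp_time <= 200 * N + 200].
Proof.
have p0 : 0 < 2 ^ n by rewrite expn_gt0.
have NE : N = n * n * (2 ^ n * k) by rewrite /N -!mulnA mulnCA (mulnCA (2 ^ n)).
have nnN : n * n <= N by rewrite NE leq_pmulr // muln_gt0 p0.
have kN : k <= N by rewrite /N leq_pmull // !muln_gt0 p0 n0.
have nN : n <= N by apply: leq_trans nnN; rewrite leq_pmull.
have zN : z - 23 <= 3 * N by rewrite /z; lia.
split; first by rewrite /N -mulnn -!mulnA.
- rewrite /dp_time (_ : size setup_code = 89) // (_ : size main_code = 70) //.
  by move: (_ * _) (_ * _) => a1 a2; lia.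
- rewrite /dp_time (_ : size setup_code = 89) // (_ : size main_code = 70) //.
  rewrite (_ : size copy_code = 6) // (_ : size pow_code = 5) //.
  by rewrite (_ : size main_init_code = 14) //; lia.
Qed.


End Sizes.

(** * The complete run on an encoded instance *)

Section DP.
Variables (n k : nat) (e : rel 'I_n) (s t : 'I_k -> 'I_n).
Hypotheses (sg : simple_graph e) (dt : distinct_terminals s t) (k0 : 0 < k).
Let n2 : 1 < n := terminals_card dt k0.
Let n0 : 0 < n := ltnW n2.
Let m := encode e s t.
Let X := copy_base n k.
Let z := n * n + 2 + k + k.
Let N := 2 ^ n * n * n * k.
(** This is the maximum of 23 and [z]: copying starts at 23, and a shorter input is already saved by
    the setup. *)
Let b := 23 + (z - 23).
Let G := powH (copyH m X b) (X + X) n.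
Let s0 := G (n * n + (X + 2)).
Let G1 := upd G ((G (X + X + s0) * n + s0) * k + (X + X + X)) 1.

Lemma input_sizeE : z = input_size n k.
Proof. by rewrite /z /input_size; lia. Qed.

Lemma input_copy x : 3 <= x -> x < z -> G (x + X) = m x.
Proof.
have [X61 zX] := copy_base_ge n2 k0 => x3 xz.
rewrite /G /powH (_ : (X + X <= x + X) = false) /=; last by lia.
rewrite /copyH (addnC x X) leq_add2l x3 ltn_add2l addKn (_ : x < b) // /b; lia.
Qed.

Lemma input_ok_G : input_ok e s t X G.
Proof.
have [X61 zX] := copy_base_ge n2 k0.
have nn : 2 * 2 <= n * n by apply: leq_mul.
split=> [v w|i ik|i ik|w wn].
- have vn : v * n + n <= n * n by rewrite addnC -mulSn leq_mul2r ltn_ord orbT.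
  have wn := ltn_ord w.
  (* The loop bit of vertex 0 was never copied. Its new cell lies past the input and is 0, which
     agrees with irreflexivity. *)
  case: (posnP (v * n + w)) => [vw0|vw0].
    have v0 : v = 0 :> nat by move: vw0 => /eqP; rewrite addn_eq0 muln_eq0; lia.
    have w0 : w = 0 :> nat by lia.
    have -> : v = w by apply: val_inj; rewrite /= v0 w0.
    rewrite sg.2 w0 mul0n !add0n /G /powH (_ : (X + X <= X + 2) = false) /=; last by lia.
    rewrite /copyH (_ : X + 3 <= X + 2 = false) /=; last by lia.
    by apply: encode_out; rewrite -input_sizeE; lia.
  rewrite (_ : _ + (X + 2) = v * n + w + 2 + X); last by lia.
  rewrite input_copy; [exact: encode_adj | lia | rewrite /z; lia].
- rewrite (_ : i + i + _ + 1 = (i + i).+1 + (n * n + 2) + X); last by lia.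
  rewrite input_copy /m ?encode_term /z; try by lia.
  by rewrite addnn /= odd_double uphalf_double.
- rewrite (_ : i + i + _ + 1 + 1 = i.+1.*2 + (n * n + 2) + X); last by lia.
  rewrite input_copy /m ?encode_term /z; try by lia.
  by rewrite odd_double doubleK.
- by rewrite /G /powH leq_addr ltn_add2l wn addKn.
Qed.

Lemma s0E : s0 = term_val s 0.
Proof.
have nn : 1 <= n * n by rewrite muln_gt0 n0.
rewrite /s0 (_ : n * n + _ = 0 + (n * n + 2) + X); last by lia.
by rewrite input_copy /m ?encode_term /z //; lia.
Qed.

(** The encoding is 0 beyond the input, so the flags need no initialisation. *)
Lemma G_table x : X + X + X <= x -> G x = 0.
Proof.
have [X61 zX] := copy_base_ge n2 k0 => Wx.
have nn : n <= n * n by rewrite leq_pmull // n0.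
have nz : n <= z by rewrite /z; lia.
rewrite /G /powH (_ : (x < X + X + n) = false) ?andbF; last by lia.
rewrite /copyH (_ : (x < X + b) = false) ?andbF; last by rewrite /b; lia.
by apply: encode_out; rewrite -input_sizeE; lia.
Qed.

Let sv : 'I_n := s (Ordinal k0).

Lemma s0_sv : s0 = sv.
Proof. by rewrite s0E -[0]/(val (Ordinal k0)) term_valE. Qed.

Lemma G1E : G1 = upd G (cell n k X 0 (2 ^ sv) sv) 1.
Proof.
have [_ _ _ Gp] := input_ok_G.
by rewrite /G1 s0_sv Gp ?ltn_ord // /cell addn0.
Qed.

Lemma G1_lt x : x < X + X + X -> G1 x = G x.
Proof. by move=> xW; rewrite G1E /upd /cell; case: eqP => // ?; lia. Qed.

Lemma input_ok_G1 : input_ok e s t X G1.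
Proof.
exact: (@input_ok_eq n k e s t X k0 n0 (copy_base_gt_input n2 k0) G G1 G1_lt input_ok_G).
Qed.

Lemma inv_G1 : dp_inv e s t X G1 0 0 G1.
Proof.
have G1W x : X + X + X <= x -> G1 x = (x == cell n k X 0 (2 ^ sv) sv).
  by move=> xW; rewrite G1E /upd; case: eqP => // _; rewrite G_table.
have cW i S v : X + X + X <= cell n k X i S v by apply: leq_addl.
split=> //.
- by move=> x xW; rewrite G1W //; case: eqP.
- move=> v; rewrite -s0E s0_sv => /val_inj <-.
  by rewrite G1W // eqxx.
- move=> i S v ik; rewrite G1W // eqb0 negbK => /eqP /(cell_inj ik k0) [-> -> ->].
  by apply: reach_start => //; rewrite -s0E s0_sv.
Qed.

Fixpoint main_iter c : nat * Defs.mem :=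
  if c is c'.+1 then main_step n k X c' (main_iter c').1 (main_iter c').2 else (0, G1).

Lemma inv_main_iter c : dp_inv e s t X G1 c (main_iter c).1 (main_iter c).2.
Proof.
elim: c => [|c IH]; first exact: inv_G1.
exact: (inv_step k0 n0 (copy_base_gt_input n2 k0) input_ok_G1 IH).
Qed.

Lemma dp_runs B L : size dp_prog <= L ->
  23 <= B -> 2 ^ n <= B -> z <= B -> N <= B -> X + X + X + n * n + 2 <= B ->
  exists m', runs dp_prog (B ^ (2 ^ L)) (0, m) (dp_time n k) (end_pc.+1, m') /\
    (m' 0 != 0 <-> disjoint_paths e s t).
Proof.
move=> pL B23 pB zB NB XB.
have [X61 zX] := copy_base_ge n2 k0.
have X23 : 23 <= X by lia.
have nB : n <= B by apply: leq_trans pB; apply: ltnW; apply: ltn_expl.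
have kB : k <= B by move: zB; rewrite /z; lia.
have B1 : 1 < B by lia.
have cB : all (const_le B) dp_prog.
  have : all (const_le 23) dp_prog by [].
  by apply: sub_all => -[] //= _ c c23; apply: leq_trans B23.
have seg T st st' : run dp_prog st T = Some st' -> words_le B st.2 ->
    T <= size dp_prog -> runs dp_prog (B ^ (2 ^ L)) st T st'.
  by move=> rT stB TL; apply: runs_of_run => //; apply: leq_trans pL.
have mB x : m x <= B by apply: leq_trans (encode_le _ _ _ _) _; rewrite -input_sizeE.
have copyB j x : copyH m X j x <= B by rewrite /copyH; case: ifP.
have powB j x : j <= n -> powH (copyH m X b) (X + X) j x <= B.
  move=> jn; rewrite /powH; case: ifP => // /andP[_ xj]; apply: leq_trans pB.
  by rewrite leq_exp2l //; lia.
have GB x : G x <= B by apply: powB.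
(* The invariant bounds the heap as well: below the table it is unchanged, and inside the table all
   words are at most 1. *)
have itB c x : (main_iter c).2 x <= B.
  have [iH fH _ _ _ _ _] := inv_main_iter c.
  case: (ltnP x (X + X + X)) => xW; first by rewrite iH // G1_lt.
  by apply: leq_trans (fH _ xW) _; lia.
have aB c : (main_iter c).1 <= B.
  by apply: leq_trans (inv_ans (inv_main_iter c)) _; lia.
have bB : b <= B by rewrite /b; lia.
have m1 : m 1 = k by [].
have r0 : runs dp_prog (B ^ (2 ^ L)) (0, m) 1 (1, m).
  by apply: seg => //; apply: (@run_jnz _ _ 1 (end_pc + 2)); rewrite ?m1 -?lt0n.
have r1 := runs_trans r0 (seg _ _ _ (@run_setup m n k erefl erefl X23) mB isT).
pose stc c := reg_mem (regs n k X z (23 + c) 0) (copyH m X (23 + c)).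
have stcB c : 23 + c <= b -> words_le B (stc c).
  by move=> cb; apply: regs_words => //; apply: leq_trans bB.
have rc : runs dp_prog (B ^ (2 ^ L)) (copy_pc, stc 0) ((z - 23) * (size copy_code + 3))
    (copy_pc, stc (z - 23)).
  apply: runs_iter => [|c cz]; first by apply: seg => //; apply: stcB; rewrite leq_add2l.
  apply: seg => //; last by apply: stcB; rewrite leq_add2l ltnW.
  rewrite /stc addnS; apply: run_copy => //; try by lia.
  by move=> x /andP[_ xz]; rewrite /copyH (_ : (X + 3 <= x) = false) //; lia.
have r2 := runs_trans r1 rc.
have zb : z <= b by rewrite /b; lia.
have r3 := runs_trans r2 (seg _ _ _ (run_copy_exit n k X _ zb)
  (stcB _ (leqnn _)) isT).
have r4 := runs_trans r3 (seg _ _ _ (run_pow_init n k X z b _)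
  (stcB _ (leqnn _)) isT).
pose stp c := reg_mem (regs n k X (2 ^ c) c 0) (powH (copyH m X b) (X + X) c).
have stpB c : c <= n -> words_le B (stp c).
  move=> cn; apply: regs_words => //.
  - by apply: leq_trans pB; rewrite leq_exp2l.
  - exact: leq_trans nB.
  - by move=> x; apply: powB.
have rp : runs dp_prog (B ^ (2 ^ L)) (pow_pc, stp 0) (n * (size pow_code + 3))
    (pow_pc, stp n).
  apply: runs_iter => [|c cn]; first by apply: seg => //; apply: stpB.
  by apply: seg => //; [apply: run_pow | apply: stpB; apply: ltnW].
rewrite {1}/stp powH0 in rp.
have r5 := runs_trans r4 rp.
have r6 := runs_trans r5 (seg _ _ _ (run_pow_exit n k X _ _)
  (stpB _ (leqnn _)) isT).
have r7 := runs_trans r6 (seg _ _ _ (@run_main_init n k X n (2 ^ n) G X23)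
  (stpB _ (leqnn _)) isT).
pose stm c := reg_mem (regs n k X N c (main_iter c).1) (main_iter c).2.
have stmB c : c <= N -> words_le B (stm c).
  by move=> cN; apply: regs_words => //; apply: leq_trans NB.
have rm : runs dp_prog (B ^ (2 ^ L)) (main_pc, stm 0) (N * (size main_code + 3))
    (main_pc, stm N).
  apply: runs_iter => [|c cN]; first by apply: seg => //; apply: stmB.
  by apply: seg => //; [apply: run_main | apply: stmB; apply: ltnW].
have r8 := runs_trans r7 rm.
have r9 := runs_trans r8 (seg _ _ _ (run_main_exit n k X N _ _)
  (stmB _ (leqnn _)) isT).
have r10 := runs_trans r9 (seg _ _ _ (run_end n k X N N _ _)
  (stmB _ (leqnn _)) isT).
exists (upd (stm N) 0 (main_iter N).1); split; first exact: r10.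
rewrite /upd eqxx; exact: (inv_final k0 n0 (inv_main_iter N)).
Qed.

End DP.

(* There is a word-RAM program that, on every Disjoint Paths instance with n
   vertices and k terminal pairs, halts within C * 2^n * n^2 * k + C steps
   and answers correctly (M[0] <> 0 iff yes-instance), using words of
   O(log(input size + running time)) bits. *)
Theorem theorem6p1 :
  exists (prog : seq instr) (C c : nat),
    forall (n k : nat) (e : rel 'I_n) (s t : 'I_k -> 'I_n),
      simple_graph e -> distinct_terminals s t ->
      exists (T : nat) (st' : state),
        [/\ halts_in prog (0, encode e s t) T st',
            T <= C * (2 ^ n * n ^ 2 * k) + C,
            word_bounded prog (0, encode e s t) T ((input_size n k + T + 2) ^ c)
          & (st'.2 0 != 0 <-> disjoint_paths e s t)].
Proof.
(* Keeping [L] abstract prevents the unary number [2 ^ L] from being computed. *)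
have [L pL] : exists L, size dp_prog <= L by exists (size dp_prog).
(* The 4 bounds words at segment heads, as [copy_base] is quadratic in the input size; the factor
   [2 ^ L] pays for at most [L] squarings within a segment. *)
exists dp_prog, 200, (4 * 2 ^ L) => n k e s t sg dt.
case: (posnP k) => [k0|k0].
  exists 2, (end_pc.+3, upd (encode e s t) 0 1).
  have r1 : run dp_prog (0, encode e s t) 1 = Some (end_pc + 2, encode e s t).
    by apply: (@run_jz _ _ 1); rewrite ?k0.
  have r2 : run dp_prog (0, encode e s t) 2 = Some (end_pc.+3, upd (encode e s t) 0 1).
    by rewrite -[2]/(1 + 1) run_add r1.
  split.
  - by split.
  (* The product is 0 when [k = 0]; the additive constant absorbs the two steps. *)
  - exact: (@leq_trans 200 2 _ isT (leq_addl _ _)).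
  - move=> i sti iT ri a.
    set B := input_size n k + 2 + 2.
    have BL : B <= B ^ (4 * 2 ^ L) by rewrite -{1}(expn1 B) leq_exp2l // muln_gt0 expn_gt0.
    have mB : words_le B (encode e s t).
      by move=> x; apply: leq_trans (encode_le _ _ _ _) _; rewrite /B; lia.
    apply: leq_trans BL.
    case: i iT ri => [|[|[|i]]] // _; first by case=> <-; apply: mB.
      by rewrite r1 => -[<-]; apply: mB.
    by rewrite r2 => -[<-] /=; rewrite /upd; case: eqP => // _; apply: mB.
  - split=> // _; have no (i : 'I_k) : False by case: i => i; rewrite k0.
    by exists (fun i => match no i with end); split=> i; case: (no i).
have n2 := terminals_card dt k0; have n0 := ltnW n2.
have [NE Tlo Thi] := dp_time_bounds n2 k0.
set T := dp_time n k in Tlo Thi.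
set B := input_size n k + T + 2.
have B25 : 25 <= B by rewrite /B; lia.
have BB : B <= B ^ 4 by rewrite -{1}(expn1 B) leq_exp2l //; lia.
have pN : 2 ^ n <= 2 ^ n * n * n * k.
  by rewrite -!mulnA leq_pmulr // !muln_gt0 n0.
have XB : copy_base n k + copy_base n k + copy_base n k + n * n + 2 <= B ^ 4.
  have nn : n <= n * n by rewrite leq_pmull // n0.
  have QB : n * n + k + k + n <= 2 * B by rewrite /B /input_size; lia.
  have nB : n * n + 2 <= B by rewrite /B /input_size; lia.
  have X4 : copy_base n k <= 4 * (B * B).
    apply: leq_trans (leq_subr _ _) _; apply: leq_trans (leq_mul QB QB) _; lia.
  have BB1 : B <= B * B by rewrite leq_pmulr //; lia.
  have -> : B ^ 4 = (B * B) * (B * B) by rewrite !expnS expn0 muln1 !mulnA.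
  have h : 25 * (B * B) <= (B * B) * (B * B) by rewrite leq_mul2r (leq_trans B25 BB1) orbT.
  lia.
have [||||m' [[rT wT] ans]] := dp_runs sg dt k0 pL (B := B ^ 4) _ _ _ _ XB.
- lia.
- by apply: leq_trans BB; rewrite /B; lia.
- by apply: leq_trans BB; rewrite /B /input_size; lia.
- by apply: leq_trans BB; rewrite /B; lia.
exists T, (end_pc.+1, m'); split=> //.
- by rewrite -NE.
- by move=> i sti iT ri; rewrite expnM; apply: wT ri.
Qed.
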